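(* Suppose $G$ is a nontrivial finite group. Then there is a $G$-primitive matrix $A$ over $\mathbb{Z}_+G$ such that the collection $\mathfrak M(A)$ contains infinitely many $SE$-$\mathbb{Z}G$ equivalence classes, i.e. contains infinitely many matrices which are pairwise not shift equivalent over $\mathbb{Z}G$. Here $\mathfrak M(A)$ is the collection of $G$-primitive matrices $B$ over $\mathbb{Z}_+G$ such that (1) $\overline A$ and $\overline B$ are strong shift equivalent over $\mathbb{Z}_+$, and (2) $B$ and $A$ have the same periodic data, i.e. $\kappa(\mathrm{tr}(A^k))=\kappa(\mathrm{tr}(B^k))$ for all $k\ge1$.
   Context: $\mathbb{Z}G$ is the integral group ring and $\mathbb{Z}_+G$ is the set of elements $\sum_g n_g g$ with all $n_g\ge0$. A square matrix $A$ over $\mathbb{Z}_+G$ is $G$-primitive if for some $k>0$ every entry of $A^k$ has the form $\sum_g n_g g$ with $n_g>0$ for every $g\in G$. $\overline A$ is the matrix obtained by applying the augmentation $\sum_g n_g g\mapsto\sum_g n_g$ entrywise. $\kappa:\mathbb{Z}G\to\mathbb{Z}\mathrm{Conj}\,G$ is the additive homomorphism to the free abelian group on the conjugacy classes of $G$ sending $\sum_g n_g g$ to $\sum_g n_g\kappa(g)$, where $\kappa(g)$ is the conjugacy class of $g$. (If $G$ is abelian, condition (2) means $\det(I-tB)=\det(I-tA)$.) Let $\mathcal S$ be a semiring (with 0 and 1). Square matrices $A,B$ (possibly of different sizes) are elementary strong shift equivalent over $\mathcal S$ if there are matrices $R,S$ over $\mathcal S$ with $A=RS$, $B=SR$; strong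 shift equivalence over $\mathcal S$ is the transitive closure of this relation. $A,B$ are shift equivalent (SE) over $\mathcal S$ if there are $\ell\in\mathbb{N}$ and matrices $R,S$ over $\mathcal S$ with $A^\ell=RS$, $B^\ell=SR$, $AR=RB$, $SA=BS$. *)

(* Defs.v *)
From HB Require Import structures.
From mathcomp Require Import all_boot all_order all_algebra all_fingroup.

Set Implicit Arguments.
Unset Strict Implicit.
Unset Printing Implicit Defensive.

Import GRing.Theory.
Local Open Scope ring_scope.

(* The group (semi)ring R[G], for G the whole type gT. It is an alias of      *)
(* {ffun gT -> R} because the ring structure of the latter is pointwise,      *)
(* whereas here the product is the convolution.                               *)
Definition gring (R : nzSemiRingType) (gT : finGroupType) : Type :=
  {ffun gT -> R}.

Section GringSemiRing.

Variables (R : nzSemiRingType) (gT : finGroupType).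
Implicit Types x y z : gring R gT.

HB.instance Definition _ := GRing.Nmodule.on (gring R gT).

Definition gring_one : gring R gT := [ffun g => (g == 1%g)%:R].

Definition gring_mul x y : gring R gT :=
  [ffun g => \sum_(h : gT) x h * y (h^-1 * g)%g].

Fact gring_mulA : associative gring_mul.
Proof.
move=> x y z; apply/ffunP=> g; rewrite !ffunE.
under eq_bigr => h _ do rewrite ffunE big_distrr.
under [RHS]eq_bigr => k _ do rewrite ffunE big_distrl.
rewrite exchange_big /= [RHS]exchange_big /=.
rewrite [LHS]exchange_big; apply: eq_bigr => h _ /=.
rewrite (reindex_inj (mulgI h^-1%g)) /=; apply: eq_bigr => k _.
by rewrite mulrA invMg invgK -!mulgA mulKVg.
Qed.

Fact gring_mul1 : left_id gring_one gring_mul.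
Proof.
move=> x; apply/ffunP=> g; rewrite ffunE (bigD1 1%g) //= ffunE eqxx mul1r.
rewrite invg1 mul1g big1 ?addr0 // => h /negPf h1.
by rewrite ffunE h1 mul0r.
Qed.

Fact gring_mulr1 : right_id gring_one gring_mul.
Proof.
move=> x; apply/ffunP=> g; rewrite ffunE (bigD1 g) //= ffunE mulVg eqxx mulr1.
rewrite big1 ?addr0 // => h hg; rewrite ffunE -eq_mulVg1.
by rewrite (negPf hg) mulr0.
Qed.

Fact gring_mulDl : left_distributive gring_mul +%R.
Proof.
move=> x y z; apply/ffunP=> g; rewrite !ffunE -big_split /=.
by apply: eq_bigr => h _; rewrite ffunE mulrDl.
Qed.

Fact gring_mulDr : right_distributive gring_mul +%R.
Proof.
move=> x y z; apply/ffunP=> g; rewrite !ffunE -big_split /=.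
by apply: eq_bigr => h _; rewrite ffunE mulrDr.
Qed.

Fact gring_mul0 : left_zero 0 gring_mul.
Proof.
by move=> x; apply/ffunP=> g; rewrite !ffunE big1 // => h _; rewrite ffunE mul0r.
Qed.

Fact gring_mulr0 : right_zero 0 gring_mul.
Proof.
by move=> x; apply/ffunP=> g; rewrite !ffunE big1 // => h _; rewrite ffunE mulr0.
Qed.

Fact gring_one_neq0 : gring_one != 0.
Proof.
apply/eqP=> /ffunP/(_ 1%g); rewrite !ffunE eqxx => /eqP.
by rewrite oner_eq0.
Qed.

HB.instance Definition _ := GRing.Nmodule_isNzSemiRing.Build (gring R gT)
  gring_mulA gring_mul1 gring_mulr1 gring_mulDl gring_mulDr
  gring_mul0 gring_mulr0 gring_one_neq0.

End GringSemiRing.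

HB.instance Definition _ (R : nzRingType) (gT : finGroupType) :=
  GRing.Zmodule.on (gring R gT).

Notation "'ZZ' [ gT ]" := (gring int gT) (at level 0, format "'ZZ' [ gT ]").

(* Z_+ is nat, so Z_+G is the group semiring with coefficients in nat; its    *)
(* inclusion into ZG is gring_incl.                                           *)
Notation "'ZZ+' [ gT ]" := (gring nat gT) (at level 0, format "'ZZ+' [ gT ]").

Definition gring_incl (gT : finGroupType) (x : ZZ+[gT]) : ZZ[gT] :=
  [ffun g => (x g)%:Z].

Definition augmentation (R : nzSemiRingType) (gT : finGroupType)
  (x : gring R gT) : R := \sum_(g : gT) x g.

Section Kappa.

Variable gT : finGroupType.

Definition conj_class : Type := {C : {set gT} | C \in classes [set: gT]}.
HB.instance Definition _ := Finite.on conj_class.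

Definition class_of (g : gT) : conj_class :=
  exist _ (g ^: [set: gT])%g (mem_classes (in_setT g)).

(* As Conj G is finite, {ffun conj_class -> int} is the free abelian group on *)
(* it, with basis the indicator functions conj_basis C.                       *)
Definition conj_basis (C : conj_class) : {ffun conj_class -> int} :=
  [ffun D => (D == C)%:R].

Definition kappa (x : ZZ[gT]) : {ffun conj_class -> int} :=
  \sum_(g : gT) conj_basis (class_of g) *~ x g.

End Kappa.

Section ShiftEquivalence.

Variable S : pzSemiRingType.

Definition elementary_sse m n (A : 'M[S]_m) (B : 'M[S]_n) : Prop :=
  exists (U : 'M[S]_(m, n)) (V : 'M[S]_(n, m)), A = U *m V /\ B = V *m U.

Inductive strong_shift_equivalent :
    forall m n : nat, 'M[S]_m -> 'M[S]_n -> Prop :=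
| SSE_step m n (A : 'M[S]_m) (B : 'M[S]_n) :
    elementary_sse A B -> strong_shift_equivalent A B
| SSE_trans m n p (A : 'M[S]_m) (B : 'M[S]_n) (C : 'M[S]_p) :
    strong_shift_equivalent A B -> strong_shift_equivalent B C ->
    strong_shift_equivalent A C.

Definition shift_equivalent m n (A : 'M[S]_m) (B : 'M[S]_n) : Prop :=
  exists (l : nat) (U : 'M[S]_(m, n)) (V : 'M[S]_(n, m)),
    [/\ (0 < l)%N,
        A ^+ l = U *m V, B ^+ l = V *m U,
        A *m U = U *m B & V *m A = B *m V].

End ShiftEquivalence.

Section PrimitiveMatrices.

Variable gT : finGroupType.

(* The empty matrix, vacuously primitive otherwise, is excluded.              *)
Definition G_primitive n (A : 'M[ZZ+[gT]]_n) : Prop :=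
  (0 < n)%N /\
  exists2 k : nat, (0 < k)%N &
    forall (i j : 'I_n) (g : gT), (0 < (A ^+ k) i j g)%N.

Definition same_periodic_data m n (A : 'M[ZZ[gT]]_m) (B : 'M[ZZ[gT]]_n) : Prop :=
  forall k : nat, (0 < k)%N -> kappa (\tr (A ^+ k)) = kappa (\tr (B ^+ k)).

Definition in_frakM m (A : 'M[ZZ+[gT]]_m) n (B : 'M[ZZ+[gT]]_n) : Prop :=
  [/\ G_primitive B,
      strong_shift_equivalent
        (map_mx (@augmentation nat gT) A) (map_mx (@augmentation nat gT) B) &
      same_periodic_data
        (map_mx (@gring_incl gT) A) (map_mx (@gring_incl gT) B)].

End PrimitiveMatrices.

(* Main.v *)
Require Import Defs.
From HB Require Import structures.
From mathcomp Require Import all_boot all_order all_algebra all_fingroup.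
From mathcomp Require Import zify.

(** Write N for the sum of all elements of G, q for the order of G and r for
    q + 1. Since g N = N and N^2 = q N, the elements x + y N form a central
    subring, on which the augmentation is x + y N |-> x + q y and the quotient
    by N is x + y N |-> x. All the matrices below have entries in this subring,
    so they are pairs (X, Y) of nonnegative integer matrices, standing for
    X + Y N: the integer matrix X + q Y is the augmentation, and the integer
    matrix X is what survives modulo N. The two can be prescribed almost
    independently, subject to X <= X + q Y and to congruence modulo q.

    The augmentations are higher and higher presentations of one shift of
    finite type. Take two states s and t, with r loops at each, r edges from t
    to s and q edges from s to t, and split t again and again according to the
    time until the next visit to s. After n splittings the states are s = 0, the
    states 1, ..., n, whose only outgoing edges are r edges from i to i - 1, and
    a last state n + 1, with r edges to n and r loops; s has r loops and q edges
    to each other state. Each splitting is an elementary strong shift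
    equivalence ([split_mx_step]).

    Modulo N, the q edges from s to each state are given total weight N = 0, and
    the r loops at s and at n + 1 are given total weight 1 + N = 1, while the r
    edges from i to i - 1 all have weight 1. What remains is X_n ([chain_mx]),
    lower triangular with diagonal (1, 0, ..., 0, 1): the trace of every
    positive power is 2. An element x + y N is determined by x and x + q y, so
    the traces of the powers over ZG do not depend on n ([extension_mx_trace]).
    But X_n is, up to a nilpotent part, the Jordan block with eigenvalue 1 and
    off-diagonal entry r^(n+1), because the only loop-free path from n + 1 to 0
    has weight r^(n+1). Precisely, X_n^(l+1) - X_n^l is r^(n+1) times a matrix
    unit as soon as l >= n ([chainX_step]).

    This is visible up to shift equivalence over ZG: the property that
    A^(l+1) = A^l modulo the ideal (d, N) for all large l passes from A to every
    matrix shift equivalent to it ([shift_equivalent_eventually_fixed]), and for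
    the n-th matrix and nontrivial G it holds exactly when d divides r^(n+1).
    Taking for d the powers of r separates the matrices. *)

Set Implicit Arguments.
Unset Strict Implicit.
Unset Printing Implicit Defensive.

Import GRing.Theory Num.Theory.
Local Open Scope ring_scope.

(** * Group ring elements x + y N *)

Section UnitPlusNorm.

Variables (R : comNzSemiRingType) (gT : finGroupType).

(** The element x + y N, with N the sum of all group elements. *)
Definition unit_norm (x y : R) : gring R gT := [ffun g => x *+ (g == 1%g) + y].

Lemma unit_normM x y x' y' :
  unit_norm x y * unit_norm x' y' =
  unit_norm (x * x') (x * y' + y * x' + y * y' *+ #|gT|).
Proof.
apply/ffunP=> g; rewrite !ffunE.
have pick1 (h0 : gT) (F : gT -> R) : \sum_h F h *+ (h == h0) = F h0.
  by rewrite (bigD1 h0) //= eqxx big1 ?addr0 // => h /negPf->.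
under eq_bigr => h _ do
  rewrite !ffunE -eq_mulVg1 mulrDl !mulrDr !(mulrnAl, mulrnAr).
by rewrite !big_split /= !pick1 sumr_const !addrA (eq_sym g).
Qed.

Lemma unit_norm_sum (I : finType) (x y : I -> R) :
  \sum_i unit_norm (x i) (y i) = unit_norm (\sum_i x i) (\sum_i y i).
Proof.
apply/ffunP=> g; rewrite sum_ffunE ffunE -sumrMnl -big_split /=.
by apply: eq_bigr => i _; rewrite ffunE.
Qed.

Lemma augmentation_unit_norm x y :
  augmentation (unit_norm x y) = x + y *+ #|gT|.
Proof.
rewrite /augmentation; under eq_bigr => g _ do rewrite ffunE.
rewrite big_split /= sumr_const (bigD1 1%g) //= eqxx big1 ?addr0 //.
by move=> g /negPf->.
Qed.

Definition unit_norm_mx m n (X Y : 'M[R]_(m, n)) : 'M[gring R gT]_(m, n) :=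
  \matrix_(i, j) unit_norm (X i j) (Y i j).

Lemma unit_norm_mxM m n p (X Y : 'M[R]_(m, n)) (X' Y' : 'M[R]_(n, p)) :
  unit_norm_mx X Y *m unit_norm_mx X' Y' =
  unit_norm_mx (X *m X') (X *m Y' + Y *m X' + Y *m Y' *+ #|gT|).
Proof.
apply/matrixP=> i j; rewrite !mxE.
under eq_bigr => k _ do rewrite !mxE unit_normM.
by rewrite unit_norm_sum mulmxnE !mxE -sumrMnl -!big_split.
Qed.

Lemma mxtrace_unit_norm n (X Y : 'M[R]_n) :
  \tr (unit_norm_mx X Y) = unit_norm (\tr X) (\tr Y).
Proof. by rewrite -unit_norm_sum; apply: eq_bigr => i _; rewrite mxE. Qed.

(** The coefficient of N in the k-th power of X + Y N. *)
Fixpoint norm_part n (X Y : 'M[R]_n) (k : nat) : 'M[R]_n :=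
  if k is l.+1 then
    X *m norm_part X Y l + Y *m X ^+ l + Y *m norm_part X Y l *+ #|gT|
  else 0.

Lemma unit_norm_mxX n (X Y : 'M[R]_n) k :
  unit_norm_mx X Y ^+ k = unit_norm_mx (X ^+ k) (norm_part X Y k).
Proof.
elim: k => [|k IHk]; last by rewrite !exprS IHk -!mulmxE unit_norm_mxM.
apply/matrixP=> i j; rewrite !mxE; apply/ffunP=> g.
by case: (i == j); rewrite !ffunE addr0 ?mul0rn.
Qed.

(** The k-th power of X + Y N, seen through the augmentation, which sends N to
    the order of the group. *)
Lemma exprD_norm_part n (X Y : 'M[R]_n) k :
  (X + Y *+ #|gT|) ^+ k = X ^+ k + norm_part X Y k *+ #|gT|.
Proof.
elim: k => [|k IHk]; first by rewrite /= mul0rn addr0.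
rewrite !exprS IHk /= !mulmxE mulrDl !mulrDr !mulrnDl.
by rewrite !mulrnAl !mulrnAr !addrA.
Qed.

End UnitPlusNorm.

(** * The integer matrices *)

Ltac case_eqs :=
  repeat match goal with
    |- context [@eq_op _ ?a ?b] => case: (@eqP _ a b) => ? /=
  end.

Section ChainMatrices.

Variables (R : comNzSemiRingType) (q : nat).

(** A path n + 1 -> n -> ... -> 1 -> 0 of edges of weight q + 1, with a loop of
    weight 1 at each of its ends. *)
Definition chain_mx n : 'M[R]_n.+2 :=
  \matrix_(i, j) if i == j then ((i == ord0) || (i == ord_max))%:R
                 else q.+1%:R *+ (i == j.+1 :> nat).

(** The positions of the coefficients N, which vanish in the quotient: row 0
    makes the matrix primitive, and the last diagonal entry turns the loop 1 into
    1 + N, the total weight of q + 1 loops. *)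
Definition return_mx n : 'M[R]_n.+2 :=
  \matrix_(i, j) ((i == ord0) || (i == ord_max) && (j == ord_max))%:R.

Definition split_mx n : 'M[R]_n.+2 := chain_mx n + return_mx n *+ q.

Lemma chain_mul0 n p (M : 'M[R]_(n.+2, p)) j :
  (chain_mx n *m M) ord0 j = M ord0 j.
Proof.
rewrite mxE (bigD1 ord0) //= big1 => [|k k0].
  by rewrite mxE eqxx /= mul1r addr0.
by rewrite mxE eq_sym (negPf k0) mul0r.
Qed.

Lemma chain_mulS n p (M : 'M[R]_(n.+2, p)) (k i : 'I_n.+2) j :
  i = k.+1 :> nat ->
  (chain_mx n *m M) i j = q.+1%:R * M k j + M i j *+ (i == ord_max).
Proof.
move=> ik; have ki : k != i by rewrite -val_eqE /= ik; lia.
have ik' : i != k by rewrite eq_sym.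
have i0 : i != ord0 by rewrite -val_eqE /= ik.
rewrite mxE (bigD1 k) // (bigD1 i) //= big1 => [|h /andP[hk hi]].
  rewrite !mxE eqxx (negPf i0) (negPf ik') ik eqxx addr0 /=.
  by case: (i == ord_max); rewrite ?mul1r ?mul0r ?mulr1n.
rewrite mxE eq_sym (negPf hi) ik eqSS.
by rewrite (val_eqE k h) eq_sym (negPf hk) mul0r.
Qed.

(** From a state i <= n the only path of length l >= i descends to 0 and then
    stays there. *)
Lemma chainX_low n (l : nat) (i j : 'I_n.+2) : (i <= n)%N -> (i <= l)%N ->
  (chain_mx n ^+ l) i j = q.+1%:R ^+ i *+ (j == ord0).
Proof.
elim: l i => [|l IHl] i.
  move=> _; rewrite leqn0 => /eqP i0; have -> : i = ord0 by apply: val_inj.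
  by rewrite mxE expr0 eq_sym.
rewrite exprS -mulmxE; case: i => [[|k] lt_k] /= le_n le_l.
  rewrite (_ : Ordinal lt_k = ord0) ?chain_mul0 ?IHl //; exact: val_inj.
have lt_k' : (k < n.+2)%N by lia.
rewrite (@chain_mulS _ _ _ (Ordinal lt_k')) //.
rewrite (IHl (Ordinal lt_k') (ltnW le_n) le_l).
rewrite -[_ == ord_max]/(k == n) (_ : (k == n) = false) ?addr0 /=; last by lia.
by rewrite exprS mulrnAr.
Qed.

(** A path of length l + 1 from the last state either spends one more step in
    its loop, which accounts for the power l, or leaves at once and descends to
    0; the other states have reached 0 after n steps. *)
Lemma chainX_step n (l : nat) : (n <= l)%N ->
  chain_mx n ^+ l.+1 = chain_mx n ^+ l + q.+1%:R ^+ n.+1 *: delta_mx ord_max ord0.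
Proof.
move=> le_nl; apply/matrixP=> i j; rewrite [RHS]mxE ![in X in _ + X]mxE.
have [i_n | lt_ni] := leqP i n.
  have -> : (i == ord_max) = false by rewrite -val_eqE /= ltn_eqF.
  rewrite mulr0 addr0.
  have -> : (chain_mx n ^+ l) i j = q.+1%:R ^+ i *+ (j == ord0).
    by rewrite chainX_low //; lia.
  by rewrite chainX_low //; lia.
have -> : i = ord_max by apply: val_inj => /=; have := ltn_ord i; lia.
have lt_n : (n < n.+2)%N by lia.
rewrite exprS -mulmxE (@chain_mulS _ _ _ (Ordinal lt_n)) // chainX_low //= eqxx.
by rewrite mulr1n addrC exprS mulr_natr mulrnAr.
Qed.

Lemma chainX_upper n (l : nat) (i j : 'I_n.+2) :
  (i < j)%N -> (chain_mx n ^+ l) i j = 0.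
Proof.
elim: l i => [|l IHl] i lt_ij; first by rewrite mxE -val_eqE /= ltn_eqF.
rewrite exprS -mulmxE; case: i lt_ij => [[|k] lt_k] /= lt_kj.
  by rewrite (_ : Ordinal lt_k = ord0) ?chain_mul0 ?IHl //; apply: val_inj.
have lt_k' : (k < n.+2)%N by lia.
rewrite (@chain_mulS _ _ _ (Ordinal lt_k')) // !IHl //=; last by lia.
by rewrite mulr0 mul0rn addr0.
Qed.

Lemma chainX_diag n (l : nat) (i : 'I_n.+2) :
  (chain_mx n ^+ l.+1) i i = ((i == ord0) || (i == ord_max))%:R.
Proof.
elim: l => [|l IHl]; first by rewrite expr1 mxE eqxx.
move: IHl; rewrite [_ ^+ l.+2]exprS -mulmxE.
case: i => [[|k] lt_k] /= IHl.
  rewrite (_ : Ordinal lt_k = ord0) in IHl *; last exact: val_inj.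
  by rewrite chain_mul0 IHl.
have lt_k' : (k < n.+2)%N by lia.
rewrite (@chain_mulS _ _ _ (Ordinal lt_k')) // chainX_upper //= IHl mulr0 add0r.
by case: (_ == ord_max).
Qed.

Lemma mxtrace_chainX n (l : nat) : \tr (chain_mx n ^+ l.+1) = 2%:R.
Proof.
rewrite /mxtrace (bigD1 ord0) // (bigD1 ord_max) //= big1 => [|i /andP[i0 im]].
  by rewrite !chainX_diag !eqxx /= addr0 -natrD.
by rewrite chainX_diag (negPf i0) (negPf im).
Qed.

(** The last state is split into the two states n + 1 and n + 2: [dup_mx] sends
    a state to its copies and [unsplit_mx] lists the edges leaving each new
    state, with targets among the old ones. *)
Definition dup_mx n : 'M[R]_(n.+2, n.+3) :=
  \matrix_(i, j) (minn j n.+1 == i :> nat)%:R.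

Definition unsplit_mx n : 'M[R]_(n.+3, n.+2) :=
  \matrix_(i, j) if i == ord0 then q%:R + (j == ord0)%:R
                 else q.+1%:R *+ (i == j.+1 :> nat).

(** Out-splitting of the last state: its edges to n now leave from the copy
    n + 1, its loops from the copy n + 2. *)
Lemma split_mx_step n : elementary_sse (split_mx n) (split_mx n.+1).
Proof.
exists (dup_mx n), (unsplit_mx n); split; apply/matrixP=> i j.
  rewrite !mxE mulmxnE !mxE big_ord_recr /= (bigD1 i) //= big1 => [|k ki].
    rewrite !mxE -!val_eqE /=.
    have := ltn_ord i; have := ltn_ord j; move: (val i) (val j) => {}i {}j.
    (* The summand of index n + 2 has been split off: it only meets row n + 1. *)
    rewrite (minn_idPr (leqnSn n.+1)) => lt_j lt_i.
    rewrite (minn_idPl _ : minn i n.+1 = i); last by lia.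
    rewrite eqxx mul1r addr0 -!mulrnA -!natrD -natrM.
    case: (eqVneq i j) => [<-|ne_ij]; case: (eqVneq i 0%N) => [i0|ni0];
      rewrite /= -!(mulrnA, natrD); congr (_ *+ _); case_eqs; lia.
  rewrite !mxE /= (minn_idPl _); last by rewrite -ltnS.
  by rewrite (val_eqE k i) (negPf ki) mul0r.
have lt_j : (minn j n.+1 < n.+2)%N by rewrite ltnS geq_minr.
rewrite !mxE mulmxnE !mxE (bigD1 (Ordinal lt_j)) //= big1 => [|k kj].
  rewrite !mxE -!val_eqE /= eqxx mulr1 addr0.
  have := ltn_ord i; have := ltn_ord j; move: (val i) (val j) => {lt_j}i {}j.
  move=> lt_j lt_i.
  case: (eqVneq i j) => [<-|ne_ij]; case: (eqVneq i 0%N) => [i0|ni0];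
    rewrite /= -!(mulrnA, natrD); congr (_ *+ _); case_eqs; lia.
rewrite [dup_mx _ _ _]mxE eq_sym -[_ == _ :> nat]/(val k == val (Ordinal lt_j)).
by rewrite val_eqE (negPf kj) mulr0.
Qed.

End ChainMatrices.

(** * Invariants of shift equivalence *)

Lemma mxtrace_sse (R : comPzSemiRingType) m n (A : 'M[R]_m) (B : 'M[R]_n) k :
  elementary_sse A B -> \tr (A ^+ k.+1) = \tr (B ^+ k.+1).
Proof.
case=> U [V [-> ->]].
have shiftX l : (U *m V) ^+ l *m U = U *m (V *m U) ^+ l.
  elim: l => [|l IHl]; first by rewrite mul1mx mulmx1.
  by rewrite exprS [in RHS]exprS -!mulmxE -!mulmxA IHl.
by rewrite exprSr -mulmxE mulmxA shiftX -mulmxA mxtrace_mulC exprSr -mulmxE -mulmxA.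
Qed.

Section ConstantModulo.

Variables (gT : finGroupType) (d : int).
Implicit Types x y : ZZ[gT].

(** Having all coefficients congruent modulo d means lying in the ideal (d, N). *)
Definition norm_modulo x : Prop := forall g h : gT, (d %| x g - x h)%Z.

Lemma norm_modulo_sum (I : finType) (x : I -> ZZ[gT]) :
  (forall i, norm_modulo (x i)) -> norm_modulo (\sum_i x i).
Proof.
by move=> xP g h; rewrite !sum_ffunE -sumrB rpred_sum // => i _; apply: xP.
Qed.

Lemma norm_modulo_mull y x : norm_modulo x -> norm_modulo (y * x).
Proof.
move=> xP g h; rewrite !ffunE -sumrB rpred_sum // => k _.
by rewrite -mulrBr dvdz_mull ?xP.
Qed.

Lemma norm_modulo_mulr x y : norm_modulo x -> norm_modulo (x * y).
Proof.
have mulE g : (x * y) g = \sum_k x (g * k^-1)%g * y k.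
  have injg : injective (fun k : gT => (g * k^-1)%g) by move=> a b /mulgI/invg_inj.
  rewrite ffunE (reindex_inj injg) /=; apply: eq_bigr => k _.
  by rewrite invMg invgK -mulgA mulVg mulg1.
move=> xP g h; rewrite !mulE -sumrB rpred_sum // => k _.
by rewrite -mulrBl dvdz_mulr ?xP.
Qed.

Definition norm_modulo_mx m n (A : 'M[ZZ[gT]]_(m, n)) : Prop :=
  forall i j, norm_modulo (A i j).

Lemma norm_modulo_mx_mull m n p (A : 'M_(m, n)) (B : 'M_(n, p)) :
  norm_modulo_mx B -> norm_modulo_mx (A *m B).
Proof.
by move=> BP i j; rewrite mxE; apply: norm_modulo_sum => k; apply: norm_modulo_mull.
Qed.

Lemma norm_modulo_mx_mulr m n p (A : 'M_(m, n)) (B : 'M_(n, p)) :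
  norm_modulo_mx A -> norm_modulo_mx (A *m B).
Proof.
by move=> AP i j; rewrite mxE; apply: norm_modulo_sum => k; apply: norm_modulo_mulr.
Qed.

(** In direct limit terms, A acts as the identity modulo (d, N) on its dimension
    module. *)
Definition eventually_fixed_modulo n (A : 'M[ZZ[gT]]_n) : Prop :=
  exists k, forall l, (k <= l)%N -> norm_modulo_mx (A ^+ l.+1 - A ^+ l).

(** With A U = U B and B^l = V U, the power B^(l+s) is V A^s U, so congruences
    between powers of A become congruences between powers of B shifted by the
    lag. *)
Lemma shift_equivalent_eventually_fixed m n (A : 'M_m) (B : 'M_n) :
  shift_equivalent A B ->
  eventually_fixed_modulo A -> eventually_fixed_modulo B.
Proof.
case=> l [U [V [_ _ BVU AU _]]] [k AP]; exists (l + k)%N => t le_t.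
have UX s : U *m B ^+ s = A ^+ s *m U.
  elim: s => [|s IHs]; first by rewrite mul1mx mulmx1.
  by rewrite exprS -mulmxE mulmxA -AU -mulmxA IHs mulmxA exprS -mulmxE.
have BX s : B ^+ (l + s) = V *m (A ^+ s *m U).
  by rewrite exprD -mulmxE BVU -mulmxA UX.
rewrite -(subnKC (leq_trans (leq_addr k l) le_t)) -addnS !BX -mulmxBr -mulmxBl.
apply/norm_modulo_mx_mull/norm_modulo_mx_mulr/AP; lia.
Qed.

End ConstantModulo.

Lemma shift_equivalent_sym (S : pzSemiRingType) m n (A : 'M[S]_m) (B : 'M[S]_n) :
  shift_equivalent A B -> shift_equivalent B A.
Proof. by case=> l [U [V [l_gt0 AUV BVU AU VA]]]; exists l, V, U; split. Qed.

(** * The matrices over the group ring *)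

Section ChainExtension.

Variable gT : finGroupType.

Definition extension_mx (R : comNzSemiRingType) n : 'M[gring R gT]_n.+2 :=
  unit_norm_mx gT (chain_mx R #|gT| n) (return_mx R n).

Lemma incl_extension_mx n :
  map_mx (@gring_incl gT) (extension_mx nat n) = extension_mx int n.
Proof.
apply/matrixP=> i j; rewrite !mxE; apply/ffunP=> g; rewrite !ffunE.
by case: (i == j); rewrite -!(mulrnA, natrD) natn natz.
Qed.

Lemma augmentation_extension_mx n :
  map_mx (@augmentation nat gT) (extension_mx nat n) = split_mx nat #|gT| n.
Proof.
by apply/matrixP=> i j; rewrite !mxE augmentation_unit_norm mulmxnE !mxE.
Qed.

Lemma sse_augmentation n :
  strong_shift_equivalent (split_mx nat #|gT| 0) (split_mx nat #|gT| n).
Proof.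
elim: n => [|n IHn]; last exact: SSE_trans IHn (SSE_step (split_mx_step _ _ _)).
by apply: SSE_step; exists (split_mx nat #|gT| 0), 1%:M; rewrite mulmx1 mul1mx.
Qed.

(** A path from i of length k > i may descend to 0, wait there and use its last
    step to go from 0 to any state j with weight N. *)
Lemma norm_part_gt0 n k (i j : 'I_n.+2) : (i < k)%N ->
  (0 < norm_part gT (chain_mx nat #|gT| n) (return_mx nat n) k i j)%N.
Proof.
elim: k i => // k IHk i lt_ik /=.
set X := chain_mx _ _ n; set Y := return_mx _ n.
have [k0 | k_gt0] := posnP k.
  have -> : i = ord0 by apply: val_inj => /=; lia.
  by rewrite k0 /= !mulmx0 expr0 mulmx1 mul0rn addr0 add0r mxE.
suff XN_gt0 : (0 < (X *m norm_part gT X Y k) i j)%N.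
  by rewrite mxE [in X in (0 < X)%N]mxE -addrA; apply: ltn_addr.
case: i lt_ik => [[|p] lt_p] lt_pk.
  rewrite (_ : Ordinal lt_p = ord0) ?chain_mul0 ?IHk //; exact: val_inj.
have lt_p' : (p < n.+2)%N by lia.
rewrite (@chain_mulS _ _ _ _ _ (Ordinal lt_p')) //.
rewrite natn; apply: ltn_addr; rewrite -[X in (0 < X)%N]/(_ * _)%N muln_gt0 /=.
exact: (IHk (Ordinal lt_p') lt_pk).
Qed.

Lemma G_primitive_extension n : G_primitive (extension_mx nat n).
Proof.
split=> //; exists n.+2 => // i j g.
rewrite unit_norm_mxX mxE ffunE addrC.
exact/ltn_addr/norm_part_gt0.
Qed.

(** Both the part without N and the augmentation of the trace are independent of
    the index: the former is 2, the latter is invariant under strong shift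
    equivalence. *)
Lemma extension_mx_trace m n k :
  \tr (extension_mx int m ^+ k.+1) = \tr (extension_mx int n ^+ k.+1).
Proof.
rewrite !unit_norm_mxX !mxtrace_unit_norm !mxtrace_chainX; congr unit_norm.
have trC p : \tr (split_mx int #|gT| p ^+ k.+1) = \tr (split_mx int #|gT| 0 ^+ k.+1).
  elim: p => // p IHp; rewrite -IHp; symmetry; apply: mxtrace_sse.
  exact: split_mx_step.
have trN p : \tr (split_mx int #|gT| p ^+ k.+1) =
    2%:R + \tr (norm_part gT (chain_mx int #|gT| p) (return_mx int p) k.+1)
           * #|gT|%:R.
  rewrite /split_mx exprD_norm_part; move: (norm_part _ _ _ _) => N.
  by rewrite mxtraceD mxtrace_chainX raddfMn mulr_natr.
have := trC m; rewrite -(trC n) !trN => /addrI; apply: mulIf.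
by rewrite pnatr_eq0 -lt0n; apply/card_gt0P; exists 1%g.
Qed.

(** Comparing the coefficients at 1 and at another element discards the multiples
    of N and leaves the entry of X^(l+1) - X^l. *)
Lemma extension_mx_step n l (i j : 'I_n.+2) (g : gT) : (n <= l)%N ->
  (extension_mx int n ^+ l.+1 - extension_mx int n ^+ l) i j 1%g -
  (extension_mx int n ^+ l.+1 - extension_mx int n ^+ l) i j g =
  (#|gT|.+1%:R ^+ n.+1 *+ ((i == ord_max) && (j == ord0))) *+ (g != 1%g).
Proof.
move=> le_nl; rewrite !unit_norm_mxX chainX_step //.
move: (norm_part _ _ _ l.+1) (norm_part _ _ _ l) (_ ^+ l) => N' N X.
rewrite !mxE !ffunE eqxx mulr_natr.
move: (_ *+ (_ && _)) (X i j) (N i j) (N' i j) => c x y y'.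
by case: (g == 1%g); rewrite /= ?mulr1n ?mulr0n; lia.
Qed.

Lemma extension_mx_eventually_fixed n :
  eventually_fixed_modulo (#|gT|.+1%:R ^+ n.+1) (extension_mx int n).
Proof.
exists n => l le_nl i j g h.
set x := (extension_mx int n ^+ l.+1 - extension_mx int n ^+ l) i j.
have x1 f : (#|gT|.+1%:R ^+ n.+1 %| x 1%g - x f)%Z.
  rewrite extension_mx_step //.
  by case: (_ && _); case: (_ != _); rewrite ?mul0rn ?mulr0n ?mulr1n.
have -> : x g - x h = (x 1%g - x h) - (x 1%g - x g) by lia.
by rewrite rpredB.
Qed.

(** In the difference of consecutive large powers, the coefficients of the entry
    (n + 1, 0) at 1 and at another group element differ by (q + 1)^(n+1). *)
Lemma eventually_fixed_dvd d n : (1 < #|[set: gT]|)%N ->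
  eventually_fixed_modulo d (extension_mx int n) ->
  (d %| #|gT|.+1%:R ^+ n.+1)%Z.
Proof.
case/card_gt1P=> g [h [_ _ ne_gh]] [k fixed_k].
have [f f1] : exists f : gT, f != 1%g.
  by have [g1 | g1] := eqVneq g 1%g; [exists h; rewrite -g1 eq_sym | exists g].
have le_k : (k <= maxn k n)%N by rewrite leq_maxl.
have := fixed_k _ le_k ord_max ord0 1%g f.
by rewrite extension_mx_step ?leq_maxr // f1 !eqxx.
Qed.

Lemma shift_equivalent_extension_leq m n : (1 < #|[set: gT]|)%N ->
  shift_equivalent (extension_mx int m) (extension_mx int n) -> (m <= n)%N.
Proof.
move=> G_nontriv se_mn.
have := shift_equivalent_eventually_fixed se_mn
          (extension_mx_eventually_fixed m).
move/(eventually_fixed_dvd G_nontriv); rewrite -!natrX !natz.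
rewrite dvdzE !absz_nat dvdn_Pexp2l ?ltnS //.
by apply/card_gt0P; exists 1%g.
Qed.

End ChainExtension.

Theorem theorem4p3 (gT : finGroupType) (gT_nontrivial : (1 < #|[set: gT]|)%N) :
  exists (m : nat) (A : 'M[ZZ+[gT]]_m),
    G_primitive A /\
    exists (n : nat -> nat) (B : forall i : nat, 'M[ZZ+[gT]]_(n i)),
      (forall i : nat, in_frakM A (B i)) /\
      (forall i j : nat, i <> j ->
        ~ shift_equivalent (map_mx (@gring_incl gT) (B i))
                           (map_mx (@gring_incl gT) (B j))).
Proof.
exists 2, (extension_mx gT nat 0); split; first exact: G_primitive_extension.
exists (fun i => i.+2), (fun i => extension_mx gT nat i); split=> [i | i j ne_ij].
  split; first exact: G_primitive_extension.
    by rewrite !augmentation_extension_mx; apply: sse_augmentation.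
  move=> [//|k] _; rewrite !incl_extension_mx.
  by rewrite (extension_mx_trace gT 0 i).
rewrite !incl_extension_mx => se_ij; apply: ne_ij; apply/eqP.
rewrite eqn_leq (shift_equivalent_extension_leq gT_nontrivial se_ij) /=.
exact/(shift_equivalent_extension_leq gT_nontrivial)/shift_equivalent_sym.
Qed.
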